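(* Let $R$ be a maximal subring of a ring $T$ which is $2$-integrally closed in $T$. Then $(R:T)_l$ and $(R:T)_r$ are prime one-sided ideals of $T$ (a prime left ideal and a prime right ideal of $T$, respectively).
   Context: All rings are associative, unital with $1\neq 0$, and not necessarily commutative; subrings contain the identity of the overring. A subring $R\subsetneq T$ is a maximal subring of $T$ if there is no subring $S$ with $R\subsetneq S\subsetneq T$. $(R:T)_l:=\{x\in T\mid Tx\subseteq R\}$ and $(R:T)_r:=\{x\in T\mid xT\subseteq R\}$ are the largest left and the largest right ideal of $T$ contained in $R$. A proper one-sided ideal $P$ of $T$ is called prime if for all $a,b\in T$, $aTb\subseteq P$ implies $a\in P$ or $b\in P$. An element $t\in T$ is left (resp. right) $n$-integral over $R$ ($n\ge 1$) if it is a root of a monic polynomial of degree $n$ with coefficients from $R$ written on the left (resp. right), i.e. $t^n+r_{n-1}t^{n-1}+\cdots+r_0=0$ (resp. $t^n+t^{n-1}r_{n-1}+\cdots+r_0=0$) for some $r_i\in R$. $R$ is $n$-integrally closed in $T$ if every element of $T$ that is left $n$-integral or right $n$-integral over $R$ belongs to $R$; $R$ is integrally closed in $T$ if it is $n$-integrally closed in $T$ for every $n\ge1$. *)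

(* Defs.v *)
From mathcomp Require Import all_boot all_order all_algebra.
From mathcomp Require Import boolp classical_sets.

Set Implicit Arguments.
Unset Strict Implicit.
Unset Printing Implicit Defensive.

Import GRing.Theory.

Local Open Scope classical_set_scope.
Local Open Scope ring_scope.

Definition is_subring (T : nzRingType) (R : set T) : Prop :=
  GRing.subring_closed (mem R).

Definition maximal_subring (T : nzRingType) (R : set T) : Prop :=
  [/\ is_subring R, R `<` [set: T] &
      ~ exists S : set T, [/\ is_subring S, R `<` S & S `<` [set: T]]].

Definition left_conductor (T : nzRingType) (R : set T) : set T :=
  [set x | forall t : T, R (t * x)].

Definition right_conductor (T : nzRingType) (R : set T) : set T :=
  [set x | forall t : T, R (x * t)].

Definition left_n_integral (T : nzRingType) (R : set T) (n : nat) (t : T) :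
    Prop :=
  exists r : 'I_n -> T,
    (forall i, R (r i)) /\ t ^+ n + \sum_(i < n) r i * t ^+ i = 0.

Definition right_n_integral (T : nzRingType) (R : set T) (n : nat) (t : T) :
    Prop :=
  exists r : 'I_n -> T,
    (forall i, R (r i)) /\ t ^+ n + \sum_(i < n) t ^+ i * r i = 0.

Definition n_integrally_closed (T : nzRingType) (R : set T) (n : nat) : Prop :=
  forall t : T, left_n_integral R n t \/ right_n_integral R n t -> R t.

(* Despite its name, [idealr_closed] describes the proper LEFT ideals:
   0 \in P, 1 \notin P and a * u + v \in P for all a and all u, v \in P. *)
Definition proper_left_ideal (T : nzRingType) (P : set T) : Prop :=
  idealr_closed (mem P).

(* The proper right ideals of T are the proper left ideals of the converse
   ring T^c, in which the product of a and u is u * a. *)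
Definition proper_right_ideal (T : nzRingType) (P : set T) : Prop :=
  @idealr_closed T^c (mem P).

Definition prime_condition (T : nzRingType) (P : set T) : Prop :=
  forall a b : T, (forall t : T, P (a * t * b)) -> P a \/ P b.

Definition prime_left_ideal (T : nzRingType) (P : set T) : Prop :=
  proper_left_ideal P /\ prime_condition P.

Definition prime_right_ideal (T : nzRingType) (P : set T) : Prop :=
  proper_right_ideal P /\ prime_condition P.

(* Main.v *)
Require Import Defs.
From mathcomp Require Import all_boot all_order all_algebra.
From mathcomp Require Import boolp classical_sets.

(** The idea: let [L] be the left conductor of [R] and suppose that [a T b] is
    contained in [L] while neither [a] nor [b] lies in [L].  Put
    [J := {x | a T x is contained in L}].  Since [L] is a left ideal of [T]
    stable under right multiplication by [R], so is [J]; hence [R + J] is a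
    subring.  The left ideal [J] contains [b], so it is not contained in [R],
    and [R + J = T] by maximality.  As [a] is not in [L], some multiple
    [i := s a] is not in [R].  Writing [i = r + j] with [r] in [R] and [j] in
    [J], the element [i^2 - i r = i j = s (a j)] lies in [R], so [i] is a root
    of a monic quadratic polynomial with right coefficients in [R]; since [R] is
    2-integrally closed, [i] is in [R], a contradiction.

    Only right 2-integrality is used for the left conductor
    ([left_conductor_prime]).  The right conductor is the left conductor in the
    converse ring, where left 2-integrality becomes right 2-integrality. *)

Import GRing.Theory.
Local Open Scope classical_set_scope.
Local Open Scope ring_scope.

(** The closure conditions of [is_subring], in terms of the set [R] instead of
    boolean membership. *)
Lemma is_subringP {T : nzRingType} {R : set T} :
  is_subring R <->
  [/\ R 1, forall x y, R x -> R y -> R (x - y)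
         & forall x y, R x -> R y -> R (x * y)].
Proof.
split=> [[R1 RB RM]|[R1 RB RM]]; split.
- by move: R1; rewrite inE.
- by move=> x y Rx Ry; have := RB x y; rewrite !inE; apply.
- by move=> x y Rx Ry; have := RM x y; rewrite !inE; apply.
- by rewrite inE.
- by move=> x y; rewrite !inE; apply: RB.
- by move=> x y; rewrite !inE; apply: RM.
Qed.

Lemma maximal_subring_full {T : nzRingType} {R S : set T} :
  maximal_subring R -> is_subring S -> R `<=` S -> ~ S `<=` R ->
  forall x, S x.
Proof.
move=> [_ _ Rmax] Ssub RS nSR x; apply: contrapT => nSx.
apply: Rmax; exists S; split=> //; split=> //.
by move=> TS; apply/nSx/TS.
Qed.

Lemma left_conductor_proper_left_ideal {T : nzRingType} {R : set T} :
  maximal_subring R -> proper_left_ideal (left_conductor R).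
Proof.
move=> [/is_subringP[R1 RB RM] [_ nTR] _].
have R0 : R 0 by rewrite -(subrr 1); apply: RB.
split.
- by rewrite inE => t; rewrite mulr0.
- apply/negP; rewrite inE => L1; apply: nTR => t _.
  by have := L1 t; rewrite mulr1.
- move=> a u v; rewrite !inE => Lu Lv t; rewrite mulrDr mulrA.
  rewrite -[t * v]opprK -[- (t * v)]sub0r.
  by apply: (RB); [apply: Lu | apply: RB].
Qed.

(** The hypothesis on quadratic equations is the part of right 2-integral
    closedness that the argument needs. *)
Lemma left_conductor_prime {T : nzRingType} {R : set T} :
  maximal_subring R ->
  (forall t r, R r -> R (t * t - t * r) -> R t) ->
  prime_condition (left_conductor R).
Proof.
move=> Rmax Rint a b aTb.
have [/is_subringP[R1 RB RM] _ _] := Rmax.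
have R0 : R 0 by rewrite -(subrr 1); apply: RB.
(* [J] is a left ideal of [T] that is also stable under right multiplication
   by [R], and [a T J] is contained in [R]. *)
pose J := [set x | forall t, left_conductor R (a * t * x)].
have JB x y : J x -> J y -> J (x - y).
  by move=> Jx Jy t s; rewrite !mulrBr; apply: RB; [apply: Jx | apply: Jy].
have JMl t x : J x -> J (t * x).
  by move=> Jx u; rewrite mulrA -[a * u * t]mulrA; apply: Jx.
have JMr x r : J x -> R r -> J (x * r).
  by move=> Jx Rr t s; rewrite !mulrA; apply: RM; have := Jx t s; rewrite ?mulrA.
have J0 : J 0 by move=> t s; rewrite !mulr0.
pose S := [set x | exists r j, [/\ R r, J j & x = r + j]].
have Ssub : is_subring S.
  apply/is_subringP; split.
  - by exists 1, 0; rewrite addr0.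
  - move=> _ _ [r [j [Rr Jj ->]]] [r' [j' [Rr' Jj' ->]]].
    exists (r - r'), (j - j'); split; [exact: RB | exact: JB |].
    by rewrite opprD addrACA.
  - move=> _ _ [r [j [Rr Jj ->]]] [r' [j' [Rr' Jj' ->]]].
    (* The [J]-part is [j * r' + (r + j) * j'], written as a difference so that
       closure under subtraction applies. *)
    exists (r * r'), (j * r' - (- (r + j)) * j'); split; first exact: RM.
      by apply: JB; [apply: JMr | apply: JMl].
    by rewrite mulNr opprK mulrDr [(r + j) * r']mulrDl addrA.
have RS : R `<=` S by move=> r Rr; exists r, 0; rewrite addr0.
apply: contrapT => /not_orP[nLa nLb].
have /existsNP[s nRsa] := nLa.
have nSR : ~ S `<=` R.
  move=> SR; apply: nLb => t; apply: SR; exists 0, (t * b).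
  by split=> //; [apply: JMl | rewrite add0r].
have [r [j [Rr Jj def_sa]]] := maximal_subring_full Rmax Ssub RS nSR (s * a).
(* The root is [i = s * a], and [i * i - i * r = i * j = s * (a * 1 * j)]. *)
apply: nRsa; apply: (Rint _ r) => //.
rewrite -mulrBr {2}def_sa addrC addKr -mulrA.
by have := Jj 1 s; rewrite mulr1.
Qed.

Lemma right_2_integral_of_quadratic {T : nzRingType} {R : set T} {t r : T} :
  is_subring R -> R r -> R (t * t - t * r) -> right_n_integral R 2 t.
Proof.
move=> /is_subringP[R1 RB RM] Rr Rs.
have RN x : R x -> R (- x).
  by move=> Rx; rewrite -sub0r -(subrr 1); apply: (RB) => //; apply: RB.
exists (fun i => if i == ord0 then - (t * t - t * r) else - r); split.
  by move=> i; case: ifP => _; apply: RN.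
rewrite big_ord_recl big_ord1 /= expr0 mul1r expr1 expr2 mulrN.
by rewrite opprB addrA [t * t + _]addrC subrK subrr.
Qed.

Lemma left_2_integral_of_quadratic {T : nzRingType} {R : set T} {t r : T} :
  is_subring R -> R r -> R (t * t - r * t) -> left_n_integral R 2 t.
Proof.
move=> /is_subringP[R1 RB RM] Rr Rs.
have RN x : R x -> R (- x).
  by move=> Rx; rewrite -sub0r -(subrr 1); apply: (RB) => //; apply: RB.
exists (fun i => if i == ord0 then - (t * t - r * t) else - r); split.
  by move=> i; case: ifP => _; apply: RN.
rewrite big_ord_recl big_ord1 /= expr0 mulr1 expr1 expr2 mulNr.
by rewrite opprB addrA [t * t + _]addrC subrK subrr.
Qed.

Lemma is_subring_converse {T : nzRingType} {R : set T} :
  @is_subring T^c R <-> is_subring R.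
Proof.
by split=> /is_subringP[R1 RB RM]; apply/is_subringP; split=> // x y Rx Ry;
  apply: (RM y x).
Qed.

Lemma maximal_subring_converse {T : nzRingType} {R : set T} :
  maximal_subring R -> @maximal_subring T^c R.
Proof.
move=> [Rsub RT Rmax]; split=> //; first exact/is_subring_converse.
by move=> [S [/is_subring_converse Ssub RS ST]]; apply: Rmax; exists S.
Qed.

Theorem corollary3p3 (T : nzRingType) (R : set T)
    (hmax : maximal_subring R) (hint : n_integrally_closed R 2) :
  prime_left_ideal (left_conductor R) /\
  prime_right_ideal (right_conductor R).
Proof.
have [Rsub _ _] := hmax.
have hmaxc := maximal_subring_converse hmax.
split; split.
- exact: left_conductor_proper_left_ideal.
- apply: left_conductor_prime => // t r Rr Rtr; apply: hint; right.
  exact: right_2_integral_of_quadratic Rr Rtr.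
- exact: (left_conductor_proper_left_ideal hmaxc).
- move=> a b aTb.
  have [||//|] := left_conductor_prime hmaxc _ b a; last by left.
  + move=> t r Rr Rtr; apply: hint; left.
    exact: left_2_integral_of_quadratic Rr Rtr.
  + (* In the converse ring, [b * t * a] is the product [a * (t * b)] of [T]. *)
    by move=> t; have := aTb t; rewrite -mulrA; apply.
  + by right.
Qed.
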